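(* Let $E$ be a real normed vector space, let $\Omega$ be a nonempty open subset of $E$, let $p,q$ be nonnegative integers, and let $f:\Omega\to\mathbb{R}$, $g_i:\Omega\to\mathbb{R}$ for $i\in\{1,\dots,p\}$, and $h_j:\Omega\to\mathbb{R}$ for $j\in\{1,\dots,q\}$ be functions. Let $\hat{x}$ be a solution of the problem $$(\mathcal{P})\qquad \text{maximize } f(x)\ \text{ subject to } x\in\Omega,\ g_i(x)\ge 0 \text{ for all } i\in\{1,\dots,p\},\ h_j(x)=0 \text{ for all } j\in\{1,\dots,q\}.$$ Assume that: (i) $f$ is Hadamard differentiable at $\hat{x}$; (ii) for all $i\in\{1,\dots,p\}$ with $g_i(\hat{x})=0$, $g_i$ is Hadamard differentiable at $\hat{x}$; (iii) for all $i\in\{1,\dots,p\}$ with $g_i(\hat{x})>0$, $g_i$ is lower semicontinuous at $\hat{x}$ and Gâteaux differentiable at $\hat{x}$; (iv) for all $j\in\{1,\dots,q\}$, $h_j$ is continuous on a neighborhood of $\hat{x}$ and Hadamard differentiable at $\hat{x}$. Then there exist $\lambda_0,\dots,\lambda_p\in\mathbb{R}_+$ and $\mu_1,\dots,\mu_q\in\mathbb{R}$ satisfying the following conditions: (a) $(\lambda_0,\dots,\lambda_p,\mu_1,\dots,\mu_q)\neq(0,\dots,0)$; (b) $\lambda_i g_i(\hat{x})=0$ for all $i\in\{1,\dots,p\}$; (c) $\lambda_0D_Hf(\hat{x})+\sum_{i=1}^{p}\lambda_iD_Gg_i(\hat{x})+\sum_{j=1}^{q}\mu_jD_Hh_j(\hat{x})=0$.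 Furthermore, if (v) $D_Hh_1(\hat{x}),\dots,D_Hh_q(\hat{x})$ are linearly independent, then these multipliers also satisfy (d) $(\lambda_0,\dots,\lambda_p)\neq(0,\dots,0)$. Moreover, if (v) holds and (vi) there exists $w\in\bigcap_{j=1}^{q}\operatorname{Ker}D_Hh_j(\hat{x})$ such that $D_Gg_i(\hat{x})w>0$ for all $i\in\{1,\dots,p\}$ with $g_i(\hat{x})=0$, then $\lambda_0,\dots,\lambda_p\in\mathbb{R}_+$ and $\mu_1,\dots,\mu_q\in\mathbb{R}$ satisfying (a), (b), (c), (d) can be chosen so that (e) $\lambda_0=1$.
   Context: $\mathbb{R}_+$ denotes the set of nonnegative real numbers. A solution of $(\mathcal{P})$ is a point $\hat{x}\in\Omega$ satisfying all the constraints and such that $f(x)\le f(\hat{x})$ for every $x\in\Omega$ satisfying all the constraints. Let $E,F$ be normed vector spaces, $\Omega\subset E$ open, $f:\Omega\to F$ a mapping and $x\in\Omega$; $\mathcal{L}(E,F)$ is the space of bounded linear mappings from $E$ into $F$. Gâteaux differentiability: $f$ is Gâteaux differentiable at $x$ when there exists $D_Gf(x)\in\mathcal{L}(E,F)$ such that for all $h\in E$, $\lim_{t\downarrow 0}\frac{f(x+th)-f(x)}{t}=D_Gf(x)h$. Hadamard differentiability: $f$ is Hadamard differentiable at $x$ when there exists $D_Hf(x)\in\mathcal{L}(E,F)$ such that for all $h\in E$, for every sequence $(h_n)_{n\in\mathbb{N}}$ in $E$ converging to $h$ and every sequence $(t_n)_{n\in\mathbb{N}}$ of positive numbers converging to $0$,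 $\lim_{n\to+\infty}\frac{f(x+t_nh_n)-f(x)}{t_n}=D_Hf(x)h$. If $f$ is Hadamard differentiable at $x$, then it is Gâteaux differentiable at $x$ and $D_Gf(x)=D_Hf(x)$; so under the hypotheses $D_Gg_i(\hat{x})$ is defined for every $i\in\{1,\dots,p\}$. *)

(* Defs.v *)
From HB Require Import structures.
From mathcomp Require Import all_boot all_order all_algebra.
From mathcomp Require Import all_classical all_reals all_analysis.

Set Implicit Arguments.
Unset Strict Implicit.
Unset Printing Implicit Defensive.

Import Order.TTheory GRing.Theory Num.Theory.
Import numFieldNormedType.Exports.

Local Open Scope classical_set_scope.
Local Open Scope ring_scope.

(* A mapping defined on an open set Omega is represented by a total function on
   E whose values outside Omega are arbitrary. At a point of Omega, the limits
   and the neighbourhoods below do not depend on these values, because Omega is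
   open. *)

Section Differentiability.
Context {R : realType} {E F : normedModType R}.
Implicit Types (f L : E -> F) (x : E).

(* For linear L, linear_boundedP restates the second condition as
   `|L v| <= r * `|v| for some r and all v. *)
Definition bounded_linear L : Prop :=
  linear L /\ bounded_near L (nbhs (0 : E)).

Definition is_gateaux_derivative f x L : Prop :=
  bounded_linear L /\
  forall v : E, t^-1 *: (f (x + t *: v) - f x) @[t --> 0^'+] --> L v.

Definition is_hadamard_derivative f x L : Prop :=
  bounded_linear L /\
  forall (v : E) (v_ : nat -> E) (t_ : nat -> R),
    v_ n @[n --> \oo] --> v ->
    (forall n, 0 < t_ n) ->
    t_ n @[n --> \oo] --> 0 ->
    (t_ n)^-1 *: (f (x + t_ n *: v_ n) - f x) @[n --> \oo] --> L v.

Definition gateaux_differentiable f x : Prop :=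
  exists L, is_gateaux_derivative f x L.

Definition hadamard_differentiable f x : Prop :=
  exists L, is_hadamard_derivative f x L.

(* The derivatives are unique when they exist, since F is Hausdorff; the
   default value 0 is only used when they do not exist. *)
Definition gateaux_derivative f x : E -> F :=
  xget (fun=> 0) [set L | is_gateaux_derivative f x L].

Definition hadamard_derivative f x : E -> F :=
  xget (fun=> 0) [set L | is_hadamard_derivative f x L].

End Differentiability.

(* The library's lower_semicontinuous, localized at x. *)
Definition lower_semicontinuous_at {T : topologicalType} {R : realType}
    (f : T -> R) (x : T) : Prop :=
  forall a : R, a < f x -> exists2 V, nbhs x V & forall y, V y -> a < f y.

(* The library's free requires a finite-dimensional ambient space. *)
Definition linearly_independent {R : realType} {V : lmodType R} {q : nat}
    (v : 'I_q -> V) : Prop :=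
  forall c : 'I_q -> R, \sum_(j < q) c j *: v j = 0 -> forall j, c j = 0.

Section Problem.
Context {R : realType} {E : normedModType R} {p q : nat}.
Variables (Omega : set E) (f : E -> R) (g : 'I_p -> E -> R)
  (h : 'I_q -> E -> R).

Definition feasible (x : E) : Prop :=
  [/\ Omega x, forall i, 0 <= g i x & forall j, h j x = 0].

Definition is_solution (xh : E) : Prop :=
  feasible xh /\ forall x, feasible x -> f x <= f xh.

(* lam lists lambda_0, ..., lambda_p, with lambda_i, for i >= 1, the multiplier
   of the i-th inequality constraint. *)
Definition are_multipliers (xh : E) (lam : 'rV[R]_p.+1) (mu : 'rV[R]_q) :
    Prop :=
  [/\ forall k, 0 <= lam 0 k,
      (lam, mu) != (0, 0),
      forall i : 'I_p, lam 0 (lift ord0 i) * g i xh = 0 &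
      lam 0 ord0 *: hadamard_derivative f xh
        + \sum_(i < p) lam 0 (lift ord0 i) *: gateaux_derivative (g i) xh
        + \sum_(j < q) mu 0 j *: hadamard_derivative (h j) xh = 0 :> (E -> R)].

End Problem.

(* Main.v *)
(* If the derivatives of the equality constraints are linearly dependent, a
   dependence relation gives the multipliers. Otherwise no direction v
   annihilated by all D h_j satisfies D f v > 0 and D g_i v > 0 for every active
   i: from such a v one would reach better feasible points, because every
   direction close to v, corrected along vectors biorthogonal to the D h_j, can
   be chosen so that h vanishes exactly. The h_j being merely continuous around
   xh, this last step is topological and uses the Poincare-Miranda theorem.
   Gordan's alternative then turns the absence of v into multipliers.

   The Poincare-Miranda theorem follows from a count modulo 2 over the Kuhn
   triangulation of a cube: the cup product of the coboundaries of n labels, the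
   i-th of which is 0 on the face x_i = 0 and 1 on the opposite face, has a sum
   that does not change when the labels are modified one at a time (Stokes),
   hence equals its value 1 at the labels 0 < x_i. *)
Require Import Defs.
From HB Require Import structures.
From mathcomp Require Import all_boot all_order all_algebra.
From mathcomp Require Import all_classical all_reals all_analysis.
From mathcomp Require Import fingroup perm zify ring lra.

Set Implicit Arguments.
Unset Strict Implicit.
Unset Printing Implicit Defensive.

Import Order.TTheory GRing.Theory Num.Theory.
Import numFieldNormedType.Exports.

Local Open Scope classical_set_scope.
Local Open Scope ring_scope.

(** * The discrete Poincare-Miranda theorem *)

(* Cochains modulo 2, with bool as the field with two elements. A chain of
   points is an infinite sequence y of which a cochain of degree n only reads
   y 0, ..., y n. [cup [:: b_1; ...; b_n]] is the cup product of the coboundaries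
   of the 0-cochains b_k; [marked_cup l1 d l2] has d itself at the marked slot. *)
Section Cochains.
Context {T : Type}.
Implicit Types (y : nat -> T) (l : seq (T -> bool)) (om : (nat -> T) -> bool).

(** The number [n] is the degree of the result: an n-chain has n+1 faces, the j-th omitting y_j.
    Modulo 2 no signs are needed. *)
Definition coboundary n om y : bool := \sum_(j < n.+1) om (y \o bump j).

Fixpoint cup l y : bool :=
  if l is b :: l' then (b (y 1%N) + b (y 0%N)) * cup l' (y \o succn) else 1.

Fixpoint marked_cup l1 (d : T -> bool) l2 y : bool :=
  if l1 is b :: l1' then
    (b (y 1%N) + b (y 0%N)) * marked_cup l1' d l2 (y \o succn)
  else d (y 0%N) * cup l2 y.

Lemma addrr_bool (x : bool) : x + x = 0.
Proof. exact: addbb. Qed.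

Lemma oppr_bool (x : bool) : - x = x.
Proof. by []. Qed.

(** Faces 0 and 1 carry the same value of [om], and their first factors add up to b(y_1) + b(y_0),
    the terms in y_2 cancelling. The other faces keep the first factor. *)
Lemma coboundary_cup_cons n (b : T -> bool) om y :
  coboundary n.+2 (fun y => (b (y 1%N) + b (y 0%N)) * om (y \o succn)) y =
  (b (y 1%N) + b (y 0%N)) * coboundary n.+1 om (y \o succn).
Proof.
rewrite /coboundary big_ord_recl big_ord_recl [in RHS]big_ord_recl /=.
rewrite addrA mulrDr mulr_sumr; congr (_ + _).
  rewrite /bump /=.
  have -> : ((y \o (fun i => 1 + i)%N) \o succn) = (y \o succn) \o bump 0.
    by [].
  have -> : (y \o (fun i => ((0 < i) + i)%N)) \o succn = (y \o succn) \o bump 0.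
    by [].
  rewrite -mulrDl; congr (_ * _).
  by case: (b _) (b _) (b _) => [] [] [].
apply: eq_bigr => j _; rewrite /bump /=; congr (_ * om _).
by apply/funext => i /=; rewrite addnS.
Qed.

Lemma coboundary_cup l y : coboundary (size l).+1 (cup l) y = 0.
Proof.
elim: l y => [|b l IH] y; first by rewrite /coboundary !big_ord_recl big_ord0.
by rewrite coboundary_cup_cons IH mulr0.
Qed.

(** Leibniz rule: the products on either side of [d] are cocycles, so the coboundary acts on [d]
    alone. *)
Lemma coboundary_marked_cup l1 d l2 y :
  coboundary (size l1 + size l2).+1 (marked_cup l1 d l2) y = cup (l1 ++ d :: l2) y.
Proof.
elim: l1 y => [|b l IH] y; last by rewrite coboundary_cup_cons IH.
have := coboundary_cup l2 y; rewrite /coboundary big_ord_recl.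
move/eqP; rewrite addr_eq0 oppr_bool => /eqP H.
rewrite big_ord_recl [RHS]mulrDl; congr (_ + _).
by rewrite [RHS](congr1 _ H) mulr_sumr.
Qed.

Lemma eq_cup l y y' : (forall k, (k < (size l).+1)%N -> y k = y' k) -> cup l y = cup l y'.
Proof.
elim: l y y' => [//|b l IH] y y' /= H.
by rewrite !H // (IH _ (y' \o succn)) // => k kl; rewrite /= H.
Qed.

Lemma eq_marked_cup l1 d l2 y y' :
  (forall k, (k < (size l1 + size l2).+1)%N -> y k = y' k) ->
  marked_cup l1 d l2 y = marked_cup l1 d l2 y'.
Proof.
elim: l1 y y' => [|b l IH] y y' /= H; first by rewrite H // (eq_cup H).
by rewrite !H // (IH _ (y' \o succn)) // => k kl; rewrite /= H.
Qed.

Lemma cupE b0 l y :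
  cup l y = \prod_(k < size l) (nth b0 l k (y k.+1) + nth b0 l k (y k)).
Proof.
elim: l y => [|b l IH] y; first by rewrite big_ord0.
by rewrite big_ord_recl /= IH.
Qed.

Lemma cup_add_slot l1 d d' l2 y :
  cup (l1 ++ (fun x => d x + d' x) :: l2) y = cup (l1 ++ d :: l2) y + cup (l1 ++ d' :: l2) y.
Proof.
elim: l1 y => [|b l1 IH] y /=; last by rewrite IH mulrDr.
by rewrite -mulrDl addrACA.
Qed.

Lemma cup_const b0 l y k c : (k < size l)%N ->
  (forall i, (i < (size l).+1)%N -> nth b0 l k (y i) = c) -> cup l y = 0.
Proof.
move=> kl H; rewrite (cupE b0); apply/eqP/prodf_eq0; exists (Ordinal kl) => //.
by apply/eqP; rewrite [nat_of_ord _]/= (H k (leqW kl)) (H k.+1) // addrr_bool.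
Qed.

Lemma marked_cupE l1 d l2 y :
  marked_cup l1 d l2 y = cup l1 y * d (y (size l1)) * cup l2 (fun i => y (size l1 + i)%N).
Proof.
elim: l1 y => [|b l1 IH] y; first by rewrite /= mul1r.
by rewrite /= IH /= -!mulrA.
Qed.

End Cochains.

(** * Stokes' formula modulo 2 on the Kuhn triangulation *)

Section Kuhn.
Context {n m : nat}.
Local Notation point := ('I_n.+1 -> nat).
Implicit Types (z : {ffun 'I_n.+1 -> 'I_m.+1}) (s : 'S_n.+1) (b : point -> bool).

(* The k-th vertex of the Kuhn simplex of the cell z in which the coordinate i
   is incremented at time s i. *)
Definition vertex z s k : point := fun i => (z i + (s i < k))%N.

(** Multiplication by [t] pairs even with odd permutations, and paired terms cancel modulo 2. *)
Lemma sum_perm_swap (F : 'S_n.+1 -> bool) (t : 'S_n.+1) : odd_perm t ->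
  (forall s, F (s * t)%g = F s) -> \sum_s F s = 0.
Proof.
move=> todd Ft; rewrite (bigID (@odd_perm _)) /=.
rewrite (reindex_inj (mulIg t)) /=.
under eq_bigl do rewrite odd_permM todd addbT.
by under eq_bigr do rewrite Ft; rewrite addrr_bool.
Qed.

(** Exchanging the times j-1 and j moves only vertex j: both simplices share the face opposite to
    it. *)
Lemma vertex_swap z s (j : 'I_n.+1) k : (0 < j)%N -> k != j :> nat ->
  vertex z (s * tperm (inord j.-1) j)%g k = vertex z s k.
Proof.
move=> j0 kj; apply/funext => i; rewrite /vertex permM; congr (_ + nat_of_bool _)%N.
have jn : (j.-1 < n.+1)%N by rewrite (leq_ltn_trans (leq_pred _)).
by case: tpermP => [->|->|//]; rewrite inordK //; lia.
Qed.

(* The face opposite to the vertex 0 of a simplex is the face opposite to the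
   last vertex of the simplex obtained by rotation; the coordinate
   incremented first wraps around, which only matters on the sides of the cube, where om vanishes. *)
Definition rotation : 'S_n.+1 := perm (@ord_pred_inj n.+1).

Definition rotate (zs : {ffun 'I_n.+1 -> 'I_m.+1} * 'S_n.+1) :=
  ([ffun i => if zs.2 i == ord0 then ordS (zs.1 i) else zs.1 i],
   (zs.2 * rotation)%g).

Lemma rotate_inj : injective rotate.
Proof.
move=> [z s] [z' s'] [/ffunP zz' /mulIg ss']; rewrite ss' in zz' *; congr (_, _).
apply/ffunP => i; have := zz' i; rewrite !ffunE /=.
by case: ifP => // _ /ordS_inj.
Qed.

Variable om : (nat -> point) -> bool.
Hypothesis om_local : forall y y',
  (forall k, (k < n.+1)%N -> y k = y' k) -> om y = om y'.
Hypothesis om_side : forall (y : nat -> point) i (a : nat), a \in [:: 0%N; m.+1] ->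
  (forall k, (k < n.+1)%N -> y k i = a) -> om y = 0.

Lemma sum_face0 :
  \sum_z \sum_s om (vertex z s \o bump 0) =
  \sum_z \sum_s om (vertex z s \o bump n.+1).
Proof.
rewrite !pair_bigA /= [RHS](reindex_inj rotate_inj) /=.
apply: eq_bigr => -[z s] _ /=.
pose i0 := (s^-1)%g ord0.
have si0 : s i0 = ord0 by rewrite permKV.
have rE i : (s * rotation)%g i = ord_pred (s i) by rewrite permM permE.
have topE k : (k < n.+1)%N -> bump n.+1 k = k by move=> kn; rewrite /bump leqNgt kn.
(* If the cell touches the far side in direction [i0], the first face lies in the side m+1 and the
   rotated one in the side 0, so both terms vanish. *)
have [zm|zm] := eqVneq (z i0 : nat) m.
  rewrite (@om_side _ i0 m.+1) ?inE ?eqxx ?orbT //; last first.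
    by move=> k kn; rewrite /= /vertex si0 zm /= addn1.
  rewrite (@om_side _ i0 0%N) ?inE ?eqxx // => k kn.
  rewrite /= /vertex rE (topE k kn) ffunE /= si0 eqxx /= zm modnn.
  by rewrite add0n modn_small // ltnNge -ltnS kn.
apply: om_local => k kn; apply/funext => i.
rewrite /= (topE k kn) /vertex rE ffunE.
have [si|si] := eqVneq (s i) ord0.
  have -> : i = i0 by apply: (@perm_inj _ s); rewrite si si0.
  rewrite si0 /= modn_small ?ltnS; last first.
    by rewrite ltn_neqAle zm -ltnS /=.
  by rewrite (modn_small (ltnSn n)) [(n < k)%N]ltnNge -ltnS kn addn0 addn1.
congr (_ + nat_of_bool _)%N.
have s0 : (0 < s i)%N by rewrite lt0n.
rewrite /= /bump leq0n add1n -[in LHS](prednK s0) ltnS -(prednK s0) addSnnS.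
by rewrite addnC /= modnDl modn_small // (leq_ltn_trans (leq_pred _)).
Qed.

(** Faces opposite to intermediate vertices cancel in pairs within each cell by [vertex_swap]; the
    first and last faces balance by [sum_face0]. *)
Lemma sum_coboundary : \sum_z \sum_s coboundary n.+1 om (vertex z s) = 0.
Proof.
rewrite /coboundary.
under eq_bigr do rewrite exchange_big /=.
rewrite exchange_big big_ord_recl big_ord_recr /= /bump /=.
rewrite -[X in X + _]/(\sum_z \sum_s om (vertex z s \o bump 0)) sum_face0.
rewrite [X in _ + (X + _)]big1 ?add0r => [|j _].
  by rewrite /bump /= addrr_bool.
apply: big1 => z _.
apply: (@sum_perm_swap _ (tperm (inord (lift ord0 j).-1) (lift ord0 j))).
  rewrite odd_tperm; apply/eqP => /(congr1 val) /=.
  by rewrite /bump /= inordK ?(leqW (ltn_ord _)) //= add1n => /n_Sn.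
move=> s; apply: om_local => k kn; apply: (@vertex_swap _ _ (lift ord0 j)) => //.
by rewrite eq_sym neq_bump.
Qed.

End Kuhn.

(** * Labels with prescribed values on opposite faces *)

Section Labels.
Context {n m : nat}.
Local Notation point := ('I_n.+1 -> nat).
Implicit Types (z : {ffun 'I_n.+1 -> 'I_m.+1}) (s : 'S_n.+1) (l : seq (point -> bool)).

Let b0 : point -> bool := fun=> false.

Definition sided (i : 'I_n.+1) (b : point -> bool) :=
  forall x, x i \in [:: 0%N; m.+1] -> b x = (x i != 0%N).

Definition sided_seq l :=
  size l = n.+1 /\ forall i : 'I_n.+1, sided i (nth b0 l i).

Definition cup_total l := \sum_z \sum_s cup l (@vertex n m z s).

(** The difference is the total of the coboundary of a marked cup product with d + d' in the slot.
    That product vanishes on the sides of the cube: either another label is constant there, or [d]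
    and [d'] agree. *)
Lemma cup_total_slot l1 d d' l2 :
  sided_seq (l1 ++ d :: l2) -> sided_seq (l1 ++ d' :: l2) ->
  cup_total (l1 ++ d :: l2) = cup_total (l1 ++ d' :: l2).
Proof.
move=> [sz H] [_ H']; apply/eqP; rewrite -subr_eq0 oppr_bool; apply/eqP.
have {}sz : (size l1 + size l2)%N = n.
  by move: sz; rewrite size_cat /= addnS => -[].
rewrite /cup_total -big_split /=.
under eq_bigr do rewrite -big_split /=.
under eq_bigr do under eq_bigr do rewrite -cup_add_slot -coboundary_marked_cup sz.
apply: sum_coboundary => [y y' yy'|y i a ain ya]; first by apply: eq_marked_cup; rewrite sz.
rewrite marked_cupE.
have [il|il|il] := ltngtP i (size l1).
- rewrite (@cup_const _ b0 _ _ i (a != 0%N)) ?mul0r // => k kl.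
  have yk : y k i = a by apply: ya; lia.
  by have := H i (y k); rewrite nth_cat il yk; apply.
- rewrite (@cup_const _ b0 l2 _ (i - (size l1).+1) (a != 0%N)) ?mulr0 //.
    by have := ltn_ord i; lia.
  move=> k kl; have yk : y (size l1 + k)%N i = a by apply: ya; lia.
  have := H i (y (size l1 + k)%N); rewrite nth_cat ltnNge (ltnW il) /= yk.
  by rewrite -(prednK (n := (i - size l1))) ?subn_gt0 //= -subnS; apply.
- have yk : y (size l1) i = a by apply: ya; lia.
  have := H i (y (size l1)); have := H' i (y (size l1)).
  rewrite !nth_cat il ltnn subnn /= yk => -> // -> //.
  by rewrite addrr_bool mulr0 mul0r.
Qed.

Definition std_labels : seq (point -> bool) :=
  mkseq (fun k x => (0 < x (inord k))%N) n.+1.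

Lemma std_labels_sided : sided_seq std_labels.
Proof.
split=> [|i x _]; first by rewrite size_mkseq.
by rewrite nth_mkseq // inord_val lt0n.
Qed.

(** The k-th factor is 1 only if z_k = 0 and s(k) = k, so a single simplex contributes. *)
Lemma cup_total_std : cup_total std_labels = 1.
Proof.
have E z s : cup std_labels (vertex z s) =
    \prod_(k < n.+1) ((0 < z k + (s k < k.+1))%N + (0 < z k + (s k < k))%N).
  rewrite (cupE b0) size_mkseq; apply: eq_bigr => k _.
  by rewrite !nth_mkseq // !inord_val.
rewrite /cup_total; under eq_bigr do under eq_bigr do rewrite E.
rewrite pair_bigA /= (bigD1 ([ffun=> ord0], 1%g)) //= [X in _ + X]big1 ?addr0.
  by rewrite big1 // => k _; rewrite ffunE perm1 ltnS leqnn ltnn.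
move=> [z s] /= neq; apply/eqP/prodf_eq0 => /=.
have [/existsP[k zk]|/existsPn z0] := boolP [exists k, z k != ord0].
  by exists k => //; rewrite !ltn_addr ?lt0n.
have [/existsP[k sk]|/existsPn s1] := boolP [exists k, s k != k].
  exists k => //; move: (z0 k); rewrite negbK => /eqP ->.
  have {}sk : (s k == k :> nat) = false by apply/negbTE.
  by rewrite !add0n !lt0b ltnS leq_eqVlt sk addrr_bool.
case/negP: neq; apply/eqP; congr (_, _).
  by apply/ffunP => k; rewrite ffunE; move: (z0 k); rewrite negbK => /eqP.
by apply/permP => k; rewrite perm1; move: (s1 k); rewrite negbK => /eqP.
Qed.

Lemma cup_total_sided l : sided_seq l -> cup_total l = 1.
Proof.
move=> [sz H]; rewrite -cup_total_std; have [szs Hs] := std_labels_sided.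
have mix k : (k <= n.+1)%N -> sided_seq (take k std_labels ++ drop k l).
  move=> kn; split=> [|i].
    by rewrite size_cat size_takel ?szs // size_drop sz subnKC.
  rewrite nth_cat size_takel ?szs //; case: ifPn => ik; first by rewrite nth_take.
  by rewrite nth_drop subnKC // leqNgt.
have step k : (k <= n.+1)%N -> cup_total l = cup_total (take k std_labels ++ drop k l).
  elim: k => [_|k IH kn]; first by rewrite take0 drop0.
  rewrite IH ?(ltnW kn) //; have := mix _ kn; have := mix _ (ltnW kn).
  rewrite (take_nth b0) ?szs // (drop_nth b0) ?sz // cat_rcons => H1 H2.
  exact: cup_total_slot.
by rewrite (step n.+1) // take_oversize ?szs // drop_oversize ?sz // cats0.
Qed.

(** As the total is 1, some simplex has a nonzero cup product: label i changes between its vertices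
    i and i+1. *)
Lemma mixed_cell (b : 'I_n.+1 -> point -> bool) :
  (forall i, sided i (b i)) ->
  exists z, forall i, exists u v : point,
    [/\ forall j, (z j <= u j <= (z j).+1)%N, forall j, (z j <= v j <= (z j).+1)%N,
        b i u & ~~ b i v].
Proof.
move=> bs; pose l := [seq b i | i <- enum 'I_n.+1].
have szl : size l = n.+1 by rewrite size_map size_enum_ord.
have nl (i : 'I_n.+1) : nth b0 l i = b i.
  by rewrite (nth_map i) ?size_enum_ord // nth_ord_enum.
have := @cup_total_sided l (conj szl (fun i => eq_ind_r (sided i) (bs i) (nl i))).
move/eqP; rewrite /cup_total pair_bigA /=.
have [/existsP[[z s] /= nz _]|/existsPn z0] :=
    boolP [exists zs : {ffun 'I_n.+1 -> 'I_m.+1} * 'S_n.+1, cup l (vertex zs.1 zs.2) != 0];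
  last first.
  rewrite big1 // => zs _; apply/eqP; move: (z0 zs); by rewrite negbK.
exists z => i; move: nz; rewrite (cupE b0) szl => /prodf_neq0/(_ i isT).
rewrite nl.
have vz k j : (z j <= vertex z s k j <= (z j).+1)%N.
  by rewrite leq_addr -addn1 leq_add2l leq_b1.
case E: (b i (vertex z s i)); case E': (b i (vertex z s i.+1)) => // _.
- by exists (vertex z s i), (vertex z s i.+1); rewrite E E'; split.
- by exists (vertex z s i.+1), (vertex z s i); rewrite E E'; split.
Qed.

End Labels.

(** * The Poincare-Miranda theorem *)

Section PM.
Context {R : realType}.

Definition cube n (r : R) : set 'rV[R]_n := [set u | forall i, `|u 0 i| <= r].

Lemma compact_cube n (r : R) : compact (@cube n r).
Proof.
have -> : @cube n r = [set u : 'rV[R]_n | forall i, `[- r, r]%classic (u ord0 i)].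
  apply/funext => u; apply/propext.
  by split=> H i; move: (H i); rewrite /= in_itv /= ler_norml.
by apply: (@rV_compact _ _ (fun=> `[- r, r]%classic)) => _; exact: segment_compact.
Qed.

Definition grid n m (r : R) (x : 'I_n -> nat) : 'rV[R]_n :=
  \row_i (- r + 2 * r * (x i)%:R / m.+1%:R).

Lemma cube_grid n m (r : R) (x : 'I_n -> nat) : 0 <= r ->
  (forall i, (x i <= m.+1)%N) -> cube r (grid m r x).
Proof.
move=> r0 xm i; rewrite mxE ler_norml.
have x1 : (x i)%:R / m.+1%:R <= 1 :> R by rewrite ler_pdivrMr ?ltr0n // mul1r ler_nat.
have x0 : 0 <= (x i)%:R / m.+1%:R :> R by rewrite divr_ge0.
rewrite -[_ * r * _ / _]mulrA; move: x0 x1; move: (_ / _) => y y0 y1.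
by apply/andP; split; nra.
Qed.

(** Each grid has a cell on which every [F i] takes both weak signs; a cluster point of such cells,
    as the mesh tends to 0, is a common zero. *)
Lemma poincare_miranda n (r : R) (F : 'I_n -> 'rV[R]_n -> R) :
  0 < r ->
  (forall i, {within cube r, continuous (F i)}) ->
  (forall i u, cube r u -> u 0 i = - r -> F i u <= 0) ->
  (forall i u, cube r u -> u 0 i = r -> 0 <= F i u) ->
  exists2 u, cube r u & forall i, F i u = 0.
Proof.
case: n F => [|n] F r0 Fc Fl Fr; first by exists 0 => [[]|[]].
have approx m : exists a : 'rV[R]_n.+1, cube r a /\ forall i, exists u v : 'rV[R]_n.+1,
   [/\ cube r u, cube r v, 0 <= F i u, F i v <= 0
     & forall j, `|a 0 j - v 0 j| <= 2 * r / m.+1%:R /\ `|a 0 j - u 0 j| <= 2 * r / m.+1%:R].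
  (* The label is forced on the two faces, where [F i] may vanish; [Fl] and [Fr] make the forced
     values agree with the weak sign of [F i]. *)
  pose b (i : 'I_n.+1) x :=
    (x i != 0%N) && ((x i == m.+1) || (0 < F i (grid m r x))).
  have bs i : sided (m := m) i (b i).
    by move=> x; rewrite !inE /b => /orP[] /eqP ->; rewrite ?eqxx.
  have [z H] := mixed_cell bs.
  exists (grid m r (fun i => z i)); split.
    by apply: cube_grid => [|i]; rewrite ?ltW // ltnW.
  move=> i; have [u [v [zu zv bu bv]]] := H i.
  have near x : (forall j, z j <= x j <= (z j).+1)%N ->
     cube r (grid m r x) /\
     forall j, `|grid m r (fun i => z i) 0 j - grid m r x 0 j| <= 2 * r / m.+1%:R.
    move=> zx; split.
      by apply: cube_grid => [|j]; rewrite ?ltW //; case/andP: (zx j) => _ /leq_trans; apply.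
    move=> j; rewrite !mxE.
    rewrite opprD addrACA subrr add0r -mulrBl -mulrBr mulrAC.
    have c0 : 0 <= 2 * r / m.+1%:R by rewrite divr_ge0 ?mulr_ge0 ?(ltW r0).
    rewrite normrM ger0_norm // ler_piMr //.
    case/andP: (zx j) => z1; rewrite -(ler_nat R) -addn1 natrD => z2.
    by rewrite -(ler_nat R) in z1; rewrite ler_norml; lra.
  have [cu nu] := near _ zu; have [cv nv] := near _ zv.
  exists (grid m r u), (grid m r v); split=> //.
    move: bu => /andP[_ /orP[/eqP um|/ltW//]]; apply: Fr => //.
    by rewrite mxE um mulfK ?pnatr_eq0 //; lra.
  have [v0|v0] := eqVneq (v i) 0%N.
    by apply: Fl => //; rewrite mxE v0 mulr0 mul0r addr0.
  by move: bv; rewrite /b v0 /= negb_or => /andP[_]; rewrite -leNgt.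
have [a Ha] := choice approx.
have [x [cx clx]] : cube r `&` cluster (a @ \oo) !=set0.
  by apply: compact_cube; exists 0%N => // m _; exact: (Ha m).1.
exists x => // i.
(* Half of the radius covers the distance from [x] to [a m], the other half the mesh. *)
have close (U : set 'rV[R]_n.+1) : within (cube r) (nbhs x) U ->
    exists u v, [/\ U u, U v, 0 <= F i u & F i v <= 0].
  move=> /nbhs_ballP[e /= e0 eU].
  have e20 : 0 < e / 2 by rewrite divr_gt0.
  have [m0 _ Hm0] : \forall m \near \oo, 2 * r / m.+1%:R < e / 2.
    have : (fun m => 2 * r * m.+1%:R^-1) @ \oo --> 2 * r * 0.
      by apply: cvgMr; exact: cvg_harmonic.
    by rewrite mulr0 => /cvgr_lt; apply.
  have := clx (a @` [set m | (m0 <= m)%N]) (ball x (e / 2)).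
  case.
  - by exists m0 => // m /= mm; exists m.
  - exact: nbhsx_ballx.
  move=> _ [[m /= mm <-] bxa].
  have [_ /(_ i)[u [v [cu cv Fu Fv uv]]]] := Ha m.
  have em := Hm0 _ mm.
  have ball (w : 'rV[R]_n.+1) :
      (forall j, `|a m 0 j - w 0 j| <= 2 * r / m.+1%:R) -> ball x e w.
    move=> H; split=> // k j; rewrite (ord1 k) [e]splitr.
    apply: ball_triangle (bxa.2 0 j) _; rewrite /ball /= /ball_.
    exact: le_lt_trans (H j) em.
  exists u, v; split=> //; (apply: eU => //; apply: ball => j; case: (uv j) => //).
have Fx : F i @ within (cube r) (nbhs x) --> F i x.
  have := Fc i x; rewrite /continuous_at /=.
  by rewrite nbhs_subspace_in.
apply/eqP; rewrite eq_le; apply/andP; split; rewrite leNgt; apply/negP => Fi.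
  have /close[u [v [_ /= Fv _]]] : within (cube r) (nbhs x) [set y | 0 < F i y].
    exact: cvgr_gt Fx _ Fi.
  by rewrite leNgt Fv.
have /close[u [v [/= Fu _]]] : within (cube r) (nbhs x) [set y | F i y < 0].
  exact: cvgr_lt Fx _ Fi.
by rewrite leNgt Fu.
Qed.

End PM.

(** * Theorems of the alternative *)

Section Functionals.
Context {R : realType} {E : lmodType R}.
Implicit Types (L : E -> R).

(* Convertible to [linear L] for the regular module structure on R. *)
Definition functional L := forall a x y, L (a *: x + y) = a * L x + L y.

Section Morphism.
Variable (L : E -> R).
Hypothesis fL : functional L.

Lemma functionalD x y : L (x + y) = L x + L y.
Proof. by rewrite -[x]scale1r fL mul1r scale1r. Qed.

Lemma functional0 : L 0 = 0.
Proof. by apply: (addrI (L 0)); rewrite -functionalD !addr0. Qed.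

Lemma functionalZ a x : L (a *: x) = a * L x.
Proof. by rewrite -[_ *: _]addr0 fL functional0 addr0. Qed.

Lemma functionalB x y : L (x - y) = L x - L y.
Proof. by rewrite functionalD -scaleN1r functionalZ mulN1r. Qed.

Lemma functional_sum (I : finType) (c : I -> R) (e : I -> E) :
  L (\sum_i c i *: e i) = \sum_i c i * L (e i).
Proof.
rewrite (big_morph L functionalD functional0).
by apply: eq_bigr => i _; exact: functionalZ.
Qed.

End Morphism.

(* P selects the functionals taking part in the alternative, so that the
   inactive constraints get the multiplier 0. *)
Lemma gordan n (ell : 'I_n -> E -> R) (P : pred 'I_n) :
  (forall i, functional (ell i)) ->
  ~ (exists v, forall i, P i -> 0 < ell i v) ->
  exists lam : 'I_n -> R, [/\ forall i, 0 <= lam i,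
    forall i, ~~ P i -> lam i = 0, exists i, lam i != 0
    & forall v, \sum_i lam i * ell i v = 0].
Proof.
elim: n ell P => [|n IH] ell P fell nv.
  by case: nv; exists 0 => -[].
pose ell' i := ell (lift ord0 i); pose P' i := P (lift ord0 i).
have extend (lam : 'I_n -> R) c : [/\ forall i, 0 <= lam i, forall i, ~~ P' i -> lam i = 0,
    exists i, lam i != 0 & forall v, c * ell ord0 v + \sum_i lam i * ell' i v = 0] ->
    0 <= c -> (~~ P ord0 -> c = 0) -> exists lam : 'I_n.+1 -> R, [/\ forall i, 0 <= lam i,
    forall i, ~~ P i -> lam i = 0, exists i, lam i != 0
    & forall v, \sum_i lam i * ell i v = 0].
  move=> [lam0 lamP [i lami] lamv] c0 cP.
  exists (fun k => if unlift ord0 k is Some i then lam i else c); split.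
  - by move=> k; case: unliftP.
  - by move=> k; case: unliftP => [j|] ->; [exact: lamP | exact: cP].
  - by exists (lift ord0 i); rewrite liftK.
  - by move=> v; rewrite big_ord_recl unlift_none; under eq_bigr do rewrite liftK.
have [[w w0]|nw] := pselect (exists w, forall i, P' i -> 0 < ell' i w); last first.
  have [lam [lam0 lamP lami lamv]] := IH ell' P' (fun i => fell _) nw.
  by apply: (extend lam 0) => //; split=> // v; rewrite mul0r add0r.
have P0 : P ord0.
  apply/negPn/negP => nP0; apply: nv; exists w => k.
  by case: (unliftP ord0 k) => [j|] ->; [exact: w0 | rewrite (negPf nP0)].
have ell0w : ell ord0 w <= 0.
  rewrite leNgt; apply/negP => ew; apply: nv; exists w => k.
  by case: (unliftP ord0 k) => [j|] -> //; exact: w0.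
(* If the first functional vanishes identically, weight 1 on it alone suffices. *)
have [ell00|/existsNP[b b0]] := pselect (forall v, ell ord0 v = 0).
  exists (fun k => (k == ord0)%:R); split=> //.
  - by move=> k; case: eqP => // ->; rewrite P0.
  - by exists ord0; rewrite eqxx oner_eq0.
  - move=> v; rewrite big_ord_recl eqxx mul1r ell00 add0r big1 // => i _.
    by rewrite mul0r.
(* Induction on the kernel of the first functional, onto which pi projects along
   a. A solution there becomes strict for the first functional by adding a small
   multiple of a; otherwise w determines the sign of the first multiplier. *)
pose a := (ell ord0 b)^-1 *: b.
have a1 : ell ord0 a = 1 by rewrite functionalZ // mulVf //; apply/eqP.
pose pi v := v - ell ord0 v *: a.
have piE i v : ell i (pi v) = ell i v - ell ord0 v * ell i a.
  by rewrite functionalB // functionalZ.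
have [||lam [lam0 lamP [i lami] lamv]] := IH (fun i => ell' i \o pi) P'.
- by move=> i c x y; rewrite /= /ell' !piE !fell; lra.
- move=> [v v0]; apply: nv.
  have : \forall t \near (0:R)^'+, forall i, P' i -> 0 < ell' i (pi v) + t * ell' i a.
    apply: filter_forall => i; case: (boolP (P' i)) => [Pi|_]; last by near=> t.
    have : (fun t => ell' i (pi v) + t * ell' i a) @ (0:R)^'+ --> ell' i (pi v) + 0 * ell' i a.
      apply: cvgD; first exact: cvg_cst.
      apply: cvgM; last exact: cvg_cst.
      exact: cvg_within.
    rewrite mul0r addr0 => /cvgr_gt/(_ _ (v0 i Pi)).
    by apply: filterS.
  move=> Ht; near (0:R)^'+ => t.
  exists (t *: a + pi v) => k; case: (unliftP ord0 k) => [j|] -> Pk.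
    by rewrite fell addrC; move: j Pk; near: t.
  by rewrite fell piE a1 !mulr1 subrr addr0; near: t; exact: nbhs_right_gt.
(* The combination vanishes on the kernel of [ell ord0], hence is [c] times it. It is positive at
   [w], where [ell ord0] is nonpositive, so c < 0. *)
pose c := \sum_i lam i * ell' i a.
have sumE v : \sum_i lam i * ell' i v = c * ell ord0 v.
  have := lamv v; rewrite /c mulr_suml.
  under eq_bigr do rewrite /= [ell' _ _]piE mulrBr.
  rewrite sumrB => /eqP; rewrite subr_eq0 => /eqP ->.
  by apply: eq_bigr => j _; rewrite mulrA mulrAC.
apply: (extend lam (- c)).
- by split=> //; [exists i | move=> v; rewrite sumE mulNr addNr].
- have : 0 < c * ell ord0 w.
    rewrite -sumE (bigD1 i) //= ltr_pwDl //.
      have Pi : P' i by apply: contraNT lami => /lamP ->.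
      by rewrite mulr_gt0 ?w0 // lt0r lami lam0.
    apply: sumr_ge0 => j _; have [Pj|/lamP ->] := boolP (P' j); last by rewrite mul0r.
    by rewrite mulr_ge0 // ltW // w0.
  by move=> cw; rewrite oppr_ge0 leNgt; apply/negP => c0; nra.
- by rewrite P0.
Unshelve. all: by end_near.
Qed.

Lemma linearly_independentP q (ell : 'I_q -> E -> R) : linearly_independent ell <->
  forall c : 'I_q -> R, (forall v, \sum_j c j * ell j v = 0) -> forall j, c j = 0.
Proof.
have E0 c : \sum_(j < q) c j *: ell j = 0 <-> forall v, \sum_j c j * ell j v = 0.
  split=> [H v|H]; last by apply/funext => v; rewrite fct_sumE; exact: H.
  by have := congr1 (fun f => f v) H; rewrite fct_sumE.
by split=> H c /E0 /H.
Qed.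

(** By induction: a vector of the common kernel of the other functionals, normalized for the first
    one, is added to the family and used to correct the previous vectors. *)
Lemma biorthogonal q (ell : 'I_q -> E -> R) :
  (forall i, functional (ell i)) -> linearly_independent ell ->
  exists e : 'I_q -> E, forall j k, ell j (e k) = (j == k)%:R.
Proof.
elim: q ell => [|q IH] ell fell /linearly_independentP ind.
  by exists (fun=> 0) => -[].
pose ell' i := ell (lift ord0 i).
have [||e' He'] := IH ell'; first by move=> i; exact: fell.
  apply/linearly_independentP => c Hc j.
  have := ind (fun k => if unlift ord0 k is Some i then c i else 0) _ (lift ord0 j).
  rewrite liftK; apply => v; rewrite big_ord_recl unlift_none mul0r add0r.
  by under eq_bigr do rewrite liftK; exact: Hc.
pose pi v := v - \sum_k ell' k v *: e' k.
have piE j v : ell j (pi v) = ell j v - \sum_k ell' k v * ell j (e' k).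
  by rewrite functionalB // functional_sum.
have pi' j v : ell' j (pi v) = 0.
  rewrite /ell' piE (bigD1 j) //= [ell _ (e' j)]He' eqxx mulr1 big1 ?addr0 ?subrr // => k kj.
  by rewrite [ell _ (e' k)]He' eq_sym (negPf kj) mulr0.
have [b b0] : exists b, ell ord0 (pi b) != 0.
  (* Otherwise [ell ord0] is the combination of the [ell' i] with coefficients [ell ord0 (e' i)], a
     relation with coefficient -1 at index 0. *)
  apply: contrapT => H.
  have : (-1 : R) = 0; last by move/eqP; rewrite oppr_eq0 oner_eq0.
  have := ind (fun k => if unlift ord0 k is Some i then ell ord0 (e' i) else -1) _ ord0.
  rewrite unlift_none; apply => v; rewrite big_ord_recl unlift_none mulN1r.
  under eq_bigr do rewrite liftK mulrC.
  have : ell ord0 (pi v) = 0 by apply/eqP/negPn/negP => ?; apply: H; exists v.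
  by rewrite piE => /eqP; rewrite subr_eq0 => /eqP {1}->; rewrite addNr.
pose e0 := (ell ord0 (pi b))^-1 *: pi b.
have e00 : ell ord0 e0 = 1 by rewrite functionalZ // mulVf.
have e0' j : ell' j e0 = 0 by rewrite functionalZ ?pi' ?mulr0 //; exact: fell.
exists (fun k => if unlift ord0 k is Some i then e' i - ell ord0 (e' i) *: e0 else e0).
move=> j k; case: (unliftP ord0 k) => [k'|] ->; rewrite ?liftK ?unlift_none;
  case: (unliftP ord0 j) => [j'|] ->.
- rewrite functionalB // functionalZ // [ell _ e0]e0' mulr0 subr0 [ell _ _]He'.
  by rewrite (inj_eq (@lift_inj _ ord0)).
- by rewrite functionalB // functionalZ // e00 mulr1 subrr.
- exact: e0'.
- by rewrite e00.
Qed.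

End Functionals.

(** * Hadamard differentiability and equality constraints *)

Section Hadamard.
Context {R : realType} {E F : normedModType R}.
Implicit Types (f L : E -> F) (x : E).

(** The sequential definition is a joint limit in step and direction: if it failed, bad points at
    distance below 1/(n+1) would form a contradicting sequence. *)
Lemma hadamard_cvg f x L v : is_hadamard_derivative f x L ->
  (tw.1^-1 *: (f (x + tw.1 *: tw.2) - f x))
    @[tw --> filter_prod ((0:R)^'+) (nbhs v)] --> L v.
Proof.
move=> [_ H]; apply/cvgrPdist_lt => e e0; apply: contrapT => nnear.
have bad n : exists tw : R * E, [/\ 0 < tw.1, tw.1 < n.+1%:R^-1,
    `|v - tw.2| < n.+1%:R^-1 &
    e <= `|L v - tw.1^-1 *: (f (x + tw.1 *: tw.2) - f x)|].
  apply: contrapT => /forallNP nb; apply: nnear.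
  exists ([set t | 0 < t < n.+1%:R^-1], ball v n.+1%:R^-1) => /=.
    split; last by apply: nbhsx_ballx.
    near=> t; rewrite /=; apply/andP; split; first by near: t; exact: nbhs_right_gt.
    by near: t; apply: nbhs_right_lt.
  move=> [t w] /= [/andP[t0 tn] vw]; rewrite ltNge; apply/negP => ge.
  apply: (nb (t, w)); split => //=.
  by move: vw; rewrite -ball_normE.
have [tw Htw] := choice bad.
have inv0 : (fun n => n.+1%:R^-1 : R) @ \oo --> (0 : R) by exact: cvg_harmonic.
have : (tw n).1^-1 *: (f (x + (tw n).1 *: (tw n).2) - f x) @[n --> \oo] --> L v.
  apply: (H v (fun n => (tw n).2) (fun n => (tw n).1)).
  - apply/cvgrPdist_lt => d d0; move/cvgr_lt: inv0 => /(_ _ d0).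
    by apply: filterS => n; apply: lt_trans; case: (Htw n).
  - by move=> n; case: (Htw n).
  - apply/cvgrPdist_lt => d d0; move/cvgr_lt: inv0 => /(_ _ d0).
    apply: filterS => n; apply: lt_trans; case: (Htw n) => t0 tn _ _.
    by rewrite sub0r normrN gtr0_norm.
move=> /cvgrPdist_lt/(_ _ e0) near.
have [n /=] := filter_ex near.
by case: (Htw n) => _ _ _; rewrite leNgt => /negP.
Unshelve. all: by end_near.
Qed.

Lemma hadamard_gateaux f x L : is_hadamard_derivative f x L -> is_gateaux_derivative f x L.
Proof.
move=> HL; split; first by case: HL.
move=> v; have := hadamard_cvg (v := v) HL.
apply: (cvg_comp (fun t : R => (t, v))).
exact: cvg_pair cvg_id (cvg_cst _).
Qed.

Lemma is_gateaux_unique f x L L' :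
  is_gateaux_derivative f x L -> is_gateaux_derivative f x L' -> L = L'.
Proof. by move=> [_ H] [_ H']; apply/funext => v; exact: cvg_unique (H v) (H' v). Qed.

Lemma hadamard_derivativeP f x : hadamard_differentiable f x ->
  is_hadamard_derivative f x (hadamard_derivative f x).
Proof.
move=> [L HL]; apply: (xgetPex (fun=> 0) (P := is_hadamard_derivative f x)).
by exists L.
Qed.

Lemma gateaux_derivativeP f x : gateaux_differentiable f x ->
  is_gateaux_derivative f x (gateaux_derivative f x).
Proof.
move=> [L HL]; apply: (xgetPex (fun=> 0) (P := is_gateaux_derivative f x)).
by exists L.
Qed.

(** This lets the multiplier rule use the Gateaux derivative for all inequality constraints, active
    ones included. *)
Lemma gateaux_derivative_hadamard f x : hadamard_differentiable f x ->
  is_hadamard_derivative f x (gateaux_derivative f x).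
Proof.
move=> [L HL]; have HG := hadamard_gateaux HL.
by rewrite (is_gateaux_unique (gateaux_derivativeP (ex_intro _ _ HG)) HG).
Qed.

End Hadamard.

Section Constraints.
Context {R : realType} {E : normedModType R}.

Lemma cvg_ray (x v : E) :
  (x + tw.1 *: tw.2) @[tw --> filter_prod ((0:R)^'+) (nbhs v)] --> x.
Proof.
rewrite -[X in _ --> X]addr0 -(scale0r v); apply: cvgD; first exact: cvg_cst.
apply: cvgZ; last exact: cvg_snd.
by apply: (cvg_trans cvg_fst); exact: cvg_within.
Qed.

(* At v + \sum_k u_k e_k the difference quotient of h_j tends to u_j, uniformly
   on a small cube of u: it has the right signs on the faces. *)
Lemma zero_near_direction q (h : 'I_q -> E -> R) (L : 'I_q -> E -> R)
    (e : 'I_q -> E) (xh v : E) (Q : set (R * E)) :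
  (forall j, h j xh = 0) ->
  (forall j, exists2 V, nbhs xh V & {within V, continuous (h j)}) ->
  (forall j, is_hadamard_derivative (h j) xh (L j)) ->
  (forall j k, L j (e k) = (j == k)%:R) ->
  (forall j, L j v = 0) ->
  filter_prod ((0:R)^'+) (nbhs v) Q ->
  exists t w, [/\ 0 < t, Q (t, w) & forall j, h j (xh + t *: w) = 0].
Proof.
move=> hx hc hd Le Lv [[A B] /= [A0 Bv] ABQ].
have fL j : functional (L j) by exact: (hd j).1.1.
pose phi (u : 'rV[R]_q) := v + \sum_k u 0 k *: e k.
have Lphi j u : L j (phi u) = u 0 j.
  rewrite functionalD // Lv add0r functional_sum // (bigD1 j) //= Le eqxx mulr1.
  by rewrite big1 ?addr0 // => k kj; rewrite Le eq_sym (negPf kj) mulr0.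
have phic : continuous phi.
  move=> u; apply: (@cvgD _ E _ (nbhs u) _ (fun=> v)); first exact: cvg_cst.
  apply: (cvg_big add_continuous) => k _; apply: cvgZ; last exact: cvg_cst.
  exact: coord_continuous.
have phi0 : phi 0 = v by rewrite /phi big1 ?addr0 // => k _; rewrite mxE scale0r.
have [r r0 cubeB] : exists2 r, 0 < r & forall u, cube r u -> B (phi u).
  have /nbhs_ballP[d /= d0 dB] : nbhs (0 : 'rV[R]_q) (phi @^-1` B).
    by apply: phic; rewrite phi0.
  exists (d / 2); first by rewrite divr_gt0.
  move=> u cu; apply: dB; split=> // i j; rewrite (ord1 i) mxE /ball /= sub0r normrN.
  by apply: (le_lt_trans (cu j)); rewrite ltr_pdivrMr // ltr_pMr // ltr1n.
have raycvg (u : 'rV[R]_q) : (fun tu : R * 'rV[R]_q => (tu.1, phi tu.2)) @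
    filter_prod ((0:R)^'+) (nbhs u) --> filter_prod ((0:R)^'+) (nbhs (phi u)).
  move=> S [[S1 S2] /= [S1t S2u] S12]; exists (S1, phi @^-1` S2) => /=.
    by split=> //; exact: phic.
  by move=> [t w] [? ?]; exact: (S12 (t, phi w)).
(* The bound [r] fixes the sign of [h j] on the faces u_j = -r and u_j = r; the second clause gives
   the continuity in [u]. *)
pose P (t : R) (u : 'rV[R]_q) := forall j,
  `|t^-1 * h j (xh + t *: phi u) - u 0 j| < r /\
   {for xh + t *: phi u, continuous (h j)}.
have nearP (u : 'rV[R]_q) : \forall u' \near u & t \near (0:R)^'+, P t u'.
  have Fu : Filter (filter_prod ((0:R)^'+) (nbhs u)) by exact _.
  have : \forall tu \near filter_prod ((0:R)^'+) (nbhs u), P tu.1 tu.2.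
    apply: filter_forall => j; near=> tu; split; near: tu.
      have : (fun tu : R * 'rV[R]_q => (tu.1^-1 * h j (xh + tu.1 *: phi tu.2) - tu.2 0 j)) @
          filter_prod ((0:R)^'+) (nbhs u) --> L j (phi u) - u 0 j.
        apply: (@cvgB _ _ _ _ Fu).
          have := cvg_comp _ _ (raycvg u) (hadamard_cvg (v := phi u) (hd j)).
          by rewrite hx; under eq_fun do rewrite subr0.
        apply: (cvg_comp snd (fun u' : 'rV[R]_q => u' 0 j)); first exact: cvg_snd.
        exact: coord_continuous.
      rewrite Lphi subrr => /cvgrPdist_lt/(_ _ r0).
      by apply: filterS => tu; rewrite sub0r normrN.
    have [V Vx Vc] := hc j.
    have := cvg_comp _ _ (raycvg u) (@cvg_ray xh (phi u)).
    move=> /(_ V^° (nbhs_interior Vx)); apply: (@filterS _ _ Fu) => tu /= Vtu.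
    have := Vc (xh + tu.1 *: phi tu.2); rewrite /continuous_at.
    by rewrite -(nbhs_subspace_interior Vtu).
  move=> [[A' B'] /= [A'0 B'u] AB]; exists (B', A') => //= -[u' t] /= [? ?].
  exact: (AB (t, u')).
(* Compactness of the cube makes one small [t] work for all [u]. *)
have := @compact_cube R q r; move/compact_near_coveringP.
move=> /(_ R ((0:R)^'+) P _ (fun u _ => nearP u)) Pcube.
near (0:R)^'+ => t.
have t0 : 0 < t by near: t; exact: nbhs_right_gt.
have At : A t by near: t.
have Pt : cube r `<=` P t by near: t.
have [||||u cu Hu] := @poincare_miranda R q r (fun j u => h j (xh + t *: phi u)).
- exact: r0.
- move=> j; apply/continuous_in_subspaceT => u /set_mem cu.
  apply: continuous_comp; last exact: (Pt u cu j).2.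
  apply: (@cvgD _ E _ (nbhs u) _ (fun=> xh)); first exact: cvg_cst.
  by apply: cvgZ; [exact: cvg_cst | exact: phic].
- move=> j u cu uj; have [+ _] := Pt u cu j.
  rewrite uj opprK ltr_norml => /andP[_]; rewrite -ltrBrDr subrr.
  by rewrite pmulr_rlt0 ?invr_gt0 // => /ltW.
- move=> j u cu uj; have [+ _] := Pt u cu j.
  rewrite uj ltr_norml => /andP[+ _]; rewrite ltrBrDr addNr.
  by rewrite pmulr_rgt0 ?invr_gt0 // => /ltW.
by exists t, (phi u); split=> //; apply: ABQ; split => //=; exact: cubeB.
Unshelve. all: by end_near.
Qed.

End Constraints.

(** * Multipliers *)

Section Ascent.
Context {R : realType} {E : normedModType R}.

Lemma hadamard_increase (f : E -> R) (x v : E) (L : E -> R) :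
  is_hadamard_derivative f x L -> 0 < L v ->
  \forall tw \near filter_prod ((0:R)^'+) (nbhs v), f x < f (x + tw.1 *: tw.2).
Proof.
move=> fL Lv.
have pos : filter_prod ((0:R)^'+) (nbhs v) [set tw | 0 < tw.1].
  by exists ([set t | 0 < t], setT) => [|[t w] []//]; split;
    [exact: nbhs_right_gt | exact: filterT].
near=> tw.
have t0 : 0 < tw.1 by near: tw.
have : 0 < tw.1^-1 * (f (x + tw.1 *: tw.2) - f x).
  by near: tw; exact: cvgr_gt (hadamard_cvg (v := v) fL) _ Lv.
by rewrite pmulr_rgt0 ?invr_gt0 // subr_gt0.
Unshelve. all: by end_near.
Qed.

(** All short steps in directions near [v] stay in [Omega], keep the inequalities and increase [f];
    [zero_near_direction] finds one that also satisfies the equalities. *)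
Lemma no_ascent_direction (Omega : set E) p q (f : E -> R) (g : 'I_p -> E -> R)
    (h : 'I_q -> E -> R) (xh : E) (Lf : E -> R) (Lg : 'I_p -> E -> R) (Lh : 'I_q -> E -> R) :
  open Omega -> is_solution Omega f g h xh ->
  is_hadamard_derivative f xh Lf ->
  (forall i, g i xh = 0 -> is_hadamard_derivative (g i) xh (Lg i)) ->
  (forall i, 0 < g i xh -> lower_semicontinuous_at (g i) xh) ->
  (forall j, exists2 V, nbhs xh V & {within V, continuous (h j)}) ->
  (forall j, is_hadamard_derivative (h j) xh (Lh j)) ->
  linearly_independent Lh ->
  ~ exists v, [/\ 0 < Lf v, forall i, g i xh = 0 -> 0 < Lg i v
                & forall j, Lh j v = 0].
Proof.
move=> Oo [[Ox gx hx] fmax] fL gL glsc hc hL ind [v [fv gv hv]].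
have [e He] := biorthogonal (fun j => (hL j).1.1) ind.
pose Q (tw : R * E) := [/\ Omega (xh + tw.1 *: tw.2),
  forall i, 0 <= g i (xh + tw.1 *: tw.2) & f xh < f (xh + tw.1 *: tw.2)].
have nearQ : filter_prod ((0:R)^'+) (nbhs v) Q.
  have ray V : nbhs xh V ->
      \forall tw \near filter_prod ((0:R)^'+) (nbhs v), V (xh + tw.1 *: tw.2).
    exact: (@cvg_ray _ _ xh v).
  have gnear i : \forall tw \near filter_prod ((0:R)^'+) (nbhs v),
      0 <= g i (xh + tw.1 *: tw.2).
    have [g0|g0] := eqVneq (g i xh) 0.
      by apply: filterS (hadamard_increase (gL i g0) (gv i g0)) => tw; rewrite g0 => /ltW.
    have gi0 : 0 < g i xh by rewrite lt0r g0 gx.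
    have [V Vx Vg] := glsc i gi0 0 gi0.
    by apply: filterS (ray V Vx) => tw /Vg /ltW.
  near=> tw; split; near: tw.
  - exact: ray (open_nbhs_nbhs (conj Oo Ox)).
  - exact: filter_forall gnear.
  - exact: hadamard_increase fL fv.
have [t [w [_ [/= Ow gw fw] hw]]] := zero_near_direction hx hc hL He hv nearQ.
have := fmax (xh + t *: w) (And3 Ow gw hw).
by rewrite leNgt fw.
Unshelve. all: by end_near.
Qed.

End Ascent.

Section Multipliers.
Context {R : realType} {E : lmodType R}.

(** Gordan's alternative is applied after projecting onto the common kernel of the [m j] along a
    biorthogonal family [e]; the terms removed by the projection give [mu]. *)
Lemma gordan_equality n q (ell : 'I_n -> E -> R) (P : pred 'I_n) (m : 'I_q -> E -> R) :
  (forall i, functional (ell i)) -> (forall j, functional (m j)) ->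
  linearly_independent m ->
  ~ (exists v, (forall i, P i -> 0 < ell i v) /\ forall j, m j v = 0) ->
  exists (lam : 'I_n -> R) (mu : 'I_q -> R), [/\ forall i, 0 <= lam i,
    forall i, ~~ P i -> lam i = 0, exists i, lam i != 0
    & forall v, \sum_i lam i * ell i v + \sum_j mu j * m j v = 0].
Proof.
move=> fell fm ind nv; have [e He] := biorthogonal fm ind.
pose pi v := v - \sum_k m k v *: e k.
have piE L v : functional L -> L (pi v) = L v - \sum_k m k v * L (e k).
  by move=> fL; rewrite functionalB // functional_sum.
have mpi j v : m j (pi v) = 0.
  rewrite piE // (bigD1 j) //= He eqxx mulr1 big1 ?addr0 ?subrr // => k kj.
  by rewrite He eq_sym (negPf kj) mulr0.
have [||lam [lam0 lamP lami lamv]] := @gordan _ _ _ (fun i => ell i \o pi) P.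
- move=> i a x y /=; rewrite !piE // fell.
  under eq_bigr do rewrite fm mulrDl -mulrA.
  by rewrite big_split -mulr_sumr /=; ring.
- by move=> [v v0]; apply: nv; exists (pi v).
exists lam, (fun j => - \sum_i lam i * ell i (e j)); split=> // v.
rewrite -[RHS](lamv v).
under [RHS]eq_bigr do rewrite /= piE // mulrBr mulr_sumr.
rewrite sumrB; congr (_ + _); rewrite exchange_big -sumrN; apply: eq_bigr => k _.
rewrite mulNr mulr_suml; congr (- _); apply: eq_bigr => i _.
by rewrite mulrAC -mulrA.
Qed.

End Multipliers.

Section Solution.
Context {R : realType} {E : normedModType R} {p q : nat}.
Variables (f : E -> R) (g : 'I_p -> E -> R) (h : 'I_q -> E -> R) (xh : E).

Lemma are_multipliersP (lam : 'rV[R]_p.+1) (mu : 'rV[R]_q) :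
  are_multipliers f g h xh lam mu <->
  [/\ forall k, 0 <= lam 0 k, (lam, mu) != (0, 0),
      forall i : 'I_p, lam 0 (lift ord0 i) * g i xh = 0 &
      forall v, lam 0 ord0 * hadamard_derivative f xh v
        + \sum_(i < p) lam 0 (lift ord0 i) * gateaux_derivative (g i) xh v
        + \sum_(j < q) mu 0 j * hadamard_derivative (h j) xh v = 0].
Proof.
split=> -[lam0 neq comp sum0]; split=> //.
  by move=> v; have := congr1 (fun F => F v) sum0; rewrite /= !fctE !fct_sumE.
by apply/funext => v; rewrite !fctE !fct_sumE; exact: sum0.
Qed.

(** With [lam] zero, condition (c) becomes a linear relation between the derivatives of the [h j],
    forcing [mu] to vanish too. *)
Lemma multipliers_neq0 lam mu :
  linearly_independent (fun j => hadamard_derivative (h j) xh) ->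
  are_multipliers f g h xh lam mu -> lam != 0.
Proof.
move=> /linearly_independentP ind /are_multipliersP[_ neq _ sum0].
apply: contraNneq neq => lam0; rewrite lam0 in sum0 *.
apply/eqP; congr (_, _); apply/rowP => j; rewrite [RHS]mxE.
apply: (ind (fun j => mu 0 j)) => v; have := sum0 v.
by rewrite mxE mul0r add0r big1 ?add0r // => i _; rewrite mxE mul0r.
Qed.

Lemma scale_multipliers c lam mu : 0 < c ->
  are_multipliers f g h xh lam mu -> are_multipliers f g h xh (c *: lam) (c *: mu).
Proof.
move=> c0 /are_multipliersP[lam0 neq comp sum0]; apply/are_multipliersP; split.
- by move=> k; rewrite mxE mulr_ge0 // ltW.
- apply: contraNneq neq => -[/eqP + /eqP]; rewrite !scaler_eq0 (gt_eqF c0) /=.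
  by move=> /eqP -> /eqP ->.
- by move=> i; rewrite mxE -mulrA comp mulr0.
- move=> v; rewrite -[RHS](mulr0 c) -[X in _ = c * X](sum0 v) !mulrDr !mulr_sumr.
  by congr (_ + _ + _); [|apply: eq_bigr => i _..]; rewrite mxE mulrA.
Qed.

End Solution.

Theorem theorem2p2 (R : realType) (E : normedModType R) (Omega : set E)
    (p q : nat) (f : E -> R) (g : 'I_p -> E -> R) (h : 'I_q -> E -> R)
    (xh : E)
    (Omega_neq0 : Omega !=set0) (Omega_open : open Omega)
    (xh_sol : is_solution Omega f g h xh)
    (f_diff : hadamard_differentiable f xh)
    (g_active : forall i, g i xh = 0 -> hadamard_differentiable (g i) xh)
    (g_inactive : forall i, 0 < g i xh ->
      lower_semicontinuous_at (g i) xh /\ gateaux_differentiable (g i) xh)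
    (h_reg : forall j,
      (exists2 V, nbhs xh V & {within V, continuous (h j)}) /\
      hadamard_differentiable (h j) xh) :
  let h_indep := linearly_independent (fun j => hadamard_derivative (h j) xh) in
  let qualified :=
    exists w : E, (forall j, hadamard_derivative (h j) xh w = 0) /\
      (forall i, g i xh = 0 -> 0 < gateaux_derivative (g i) xh w) in
  [/\ exists (lam : 'rV[R]_p.+1) (mu : 'rV[R]_q),
        are_multipliers f g h xh lam mu,
      h_indep ->
        forall (lam : 'rV[R]_p.+1) (mu : 'rV[R]_q),
          are_multipliers f g h xh lam mu -> lam != 0 &
      h_indep -> qualified ->
        exists (lam : 'rV[R]_p.+1) (mu : 'rV[R]_q),
          [/\ are_multipliers f g h xh lam mu, lam != 0 & lam 0 ord0 = 1]].
Proof.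
move=> h_indep qualified.
have fD := hadamard_derivativeP f_diff.
have hD j := hadamard_derivativeP (h_reg j).2.
have gD i (gi0 : g i xh = 0) := gateaux_derivative_hadamard (g_active i gi0).
have gG i : is_gateaux_derivative (g i) xh (gateaux_derivative (g i) xh).
  have [g0|g0] := eqVneq (g i xh) 0; first exact/hadamard_gateaux/gD.
  have [[_ /(_ i) gx _] _] := xh_sol.
  by apply: gateaux_derivativeP; apply: (g_inactive i _).2; rewrite lt0r g0.
have exm : exists (lam : 'rV[R]_p.+1) (mu : 'rV[R]_q), are_multipliers f g h xh lam mu.
  have [ind|] := pselect h_indep; last first.
    (* A dependence relation supplies [mu], with [lam] zero. *)
    rewrite /h_indep => /linearly_independentP/existsNP[c /not_implyP[c0 /existsNP[j cj]]].
    exists 0, (\row_j c j); apply/are_multipliersP; split=> [k||i|v].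
    + by rewrite mxE.
    + apply/eqP => -[/rowP/(_ j)]; rewrite !mxE; exact: cj.
    + by rewrite mxE mul0r.
    + rewrite mxE mul0r add0r big1 ?add0r => [|i _]; last by rewrite mxE mul0r.
      by under eq_bigr do rewrite mxE; exact: c0.
  (* Index 0 stands for the objective; [P] keeps it and the active constraints, so inactive ones get
     multiplier 0, which is (b). *)
  pose ell k := if unlift ord0 k is Some i then gateaux_derivative (g i) xh
                else hadamard_derivative f xh.
  pose P k := if unlift ord0 k is Some i then g i xh == 0 else true.
  have [|||lam [mu [lam0 lamP [k lamk] sum0]]] :=
      @gordan_equality _ _ _ _ ell P (fun j => hadamard_derivative (h j) xh) _ _ ind.
  + move=> k; rewrite /ell; case: unliftP => [i|] _; [exact: (gG i).1.1 | exact: fD.1.1].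
  + by move=> j; exact: (hD j).1.1.
  + move=> [v [ellv hv]].
    apply: (no_ascent_direction Omega_open xh_sol fD gD _ (fun j => (h_reg j).1) hD ind).
      by move=> i /g_inactive[].
    exists v; split=> // [|i gi].
      by have := ellv ord0; rewrite /ell /P unlift_none; apply.
    by have := ellv (lift ord0 i); rewrite /ell /P liftK gi; apply.
  exists (\row_k lam k), (\row_j mu j); apply/are_multipliersP; split=> [i||i|v].
  + by rewrite mxE.
  + by apply: contra_neq lamk => -[/rowP/(_ k)]; rewrite !mxE.
  + rewrite mxE; have [->|g0] := eqVneq (g i xh) 0; first by rewrite mulr0.
    by rewrite lamP ?mul0r // /P liftK.
  + rewrite -[RHS](sum0 v) big_ord_recl /ell unlift_none mxE; congr (_ + _ + _).
      by apply: eq_bigr => i _; rewrite mxE liftK.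
    by apply: eq_bigr => j _; rewrite mxE.
split=> // [ind lam mu|ind [w [hw gw]]]; first exact: multipliers_neq0.
have [lam [mu lammu]] := exm; have lam_neq0 := multipliers_neq0 ind lammu.
have [lam0 _ comp sum0] := (are_multipliersP _ _ _ _ _ _).1 lammu.
have lam00 : 0 < lam 0 ord0.
  (* If lambda_0 were 0, evaluating (c) at [w] would give a zero sum of nonnegative terms. Active
     multipliers would then vanish, and inactive ones do by (b), against [lam_neq0]. *)
  rewrite lt0r lam0 andbT; apply: contra_neq lam_neq0 => l0.
  have := sum0 w; rewrite l0 mul0r add0r [X in _ + X]big1 ?addr0 => [gsum|j _]; last first.
    by rewrite hw mulr0.
  have term i : 0 <= lam 0 (lift ord0 i) * gateaux_derivative (g i) xh w.
    have [g0|g0] := eqVneq (g i xh) 0; first by rewrite mulr_ge0 // ltW // gw.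
    by have /eqP := comp i; rewrite mulf_eq0 (negPf g0) orbF => /eqP ->; rewrite mul0r.
  apply/rowP => k; rewrite [RHS]mxE; case: (unliftP ord0 k) => [i|] -> //.
  apply/eqP; have /eqP := comp i; rewrite mulf_eq0 => /orP[//|/eqP g0].
  have /eqP : lam 0 (lift ord0 i) * gateaux_derivative (g i) xh w = 0.
    exact: (psumr_eq0P (fun i _ => term i) gsum).
  by rewrite mulf_eq0 (gt_eqF (gw i g0)) orbF.
exists ((lam 0 ord0)^-1 *: lam), ((lam 0 ord0)^-1 *: mu); split.
- by apply: scale_multipliers => //; rewrite invr_gt0.
- by rewrite scaler_eq0 negb_or invr_eq0 gt_eqF.
- by rewrite mxE mulVf // gt_eqF.
Qed.
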